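(* Let $n\equiv 3\pmod 4$, i.e. $n=4m+3$ with $m\ge 0$. Then each of the polynomials $A_{4m+3}^+(t)$ and $A_{4m+3}^-(t)$ can be written as a sum of three gamma positive polynomials.
   Context: For a permutation $\pi=\pi_1\cdots\pi_n$ of $[n]$ let $\mathsf{des}(\pi)=|\{i\in[n-1]:\pi_i>\pi_{i+1}\}|$. Let $\mathfrak{S}_n$ be the symmetric group and $\mathcal{A}_n$ the alternating group. $A_n^+(t)=\sum_{\pi\in\mathcal{A}_n}t^{\mathsf{des}(\pi)}$ and $A_n^-(t)=\sum_{\pi\in\mathfrak{S}_n\setminus\mathcal{A}_n}t^{\mathsf{des}(\pi)}$. For a nonzero polynomial $f(t)=\sum_{i=r}^{N}a_it^i$ with $a_r\neq0\neq a_N$: $f$ is palindromic if $a_{r+i}=a_{N-i}$ for $0\le i\le\lfloor (N-r)/2\rfloor$; its center of symmetry is $(N+r)/2$; and $f$ is gamma positive if it is palindromic and $f(t)=\sum_{i=0}^{\lfloor (N-r)/2\rfloor}\gamma_i t^{r+i}(1+t)^{N-r-2i}$ with all $\gamma_i\geq 0$. *)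

(* Defs.v *)
From HB Require Import structures.
From mathcomp Require Import all_boot all_order all_algebra all_fingroup all_solvable.
Set Implicit Arguments.
Unset Strict Implicit.
Unset Printing Implicit Defensive.
Import Order.TTheory GRing.Theory Num.Theory.
Local Open Scope ring_scope.

(* Permutations act on {0, .., n-1}; the index i counts as a descent when it
   has a successor j = i + 1 in 'I_n and pi i > pi j. *)
Definition des (n : nat) (pi : 'S_n) : nat :=
  #|[set i : 'I_n | [exists j : 'I_n, (j == i.+1 :> nat) && (pi j < pi i)%N]]|.

Definition eulerian_plus (n : nat) : {poly rat} :=
  \sum_(pi : 'S_n | pi \in ('Alt_('I_n))%g) 'X^(des pi).

Definition eulerian_minus (n : nat) : {poly rat} :=
  \sum_(pi : 'S_n | pi \notin ('Alt_('I_n))%g) 'X^(des pi).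

Section GammaPositivity.
Variable R : realFieldType.
Implicit Type f : {poly R}.

(* For f != 0, low_deg f and high_deg f are the exponents r and N of the lowest
   and highest nonzero terms; both are junk (0) for f = 0, which is excluded
   below. *)
Definition low_deg f : nat := find (fun a : R => a != 0) f.
Definition high_deg f : nat := (size f).-1.

Definition palindromic f : Prop :=
  f != 0 /\
  forall i : nat, (i <= (high_deg f - low_deg f)./2)%N ->
    f`_(low_deg f + i) = f`_(high_deg f - i).

Definition gamma_positive f : Prop :=
  let r := low_deg f in
  let N := high_deg f in
  palindromic f /\
  exists gamma : nat -> R,
    (forall i : nat, (i <= (N - r)./2)%N -> 0 <= gamma i) /\
    f = \sum_(0 <= i < ((N - r)./2).+1)
          gamma i *: ('X^(r + i) * (1 + 'X) ^+ (N - r - 2 * i)).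

Definition sum_of_three_gamma_positive f : Prop :=
  exists f1 f2 f3 : {poly R},
    [/\ gamma_positive f1, gamma_positive f2, gamma_positive f3
      & f = f1 + f2 + f3].

End GammaPositivity.

(* Main.v *)
Require Import Defs.
From HB Require Import structures.
From mathcomp Require Import all_boot all_order all_algebra all_fingroup all_solvable.
From mathcomp Require Import ring lra zify.

(** Write A_n for the Eulerian polynomial and D_n for its version signed by the
    sign of the permutation, so that A_n^+ and A_n^- are (A_n + D_n) / 2 and
    (A_n - D_n) / 2.  Refining by the first letter gives linear recursions from
    which D_(2k+1) = (1 - t)^k A_(k+1) and A_(n+1) = (1 + n t) A_n + t (1 - t) A_n'
    follow; the latter yields the recursion of the gamma coefficients of A_n.

    For n = 4m+3 put d = 4m+1.  Then D_n = (1 - t) u with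
    u = (1 - t)^(2m) A_(2m+2), and since (1 - t)^2 = (1 + t)^2 - 4t, u has an
    expansion in the polynomials t^i (1 + t)^(d-2i), with signed coefficients
    c_i.  These satisfy |c_i| <= gamma_(n,i), so writing |u| for the polynomial
    with coefficients |c_i|,
      A_n + D_n = (A_n - (1 + t) |u|) + (|u| + u) + t (|u| - u)
    is a sum of three polynomials with nonnegative gamma coefficients; for
    A_n - D_n replace u by - u.  If a summand vanishes, another one is halved. *)

Set Implicit Arguments.
Unset Strict Implicit.
Unset Printing Implicit Defensive.
Import Order.TTheory GRing.Theory Num.Theory.
Local Open Scope ring_scope.

Lemma des_sum n (s : 'S_n.+1) :
  des s = (\sum_(i < n) (s (lift ord0 i) < s (widen_ord (leqnSn n) i)))%N.
Proof.
rewrite /des cardsE -sum1_card big_mkcond big_ord_recr /=.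
rewrite [X in (_ + X)%N]ifF ?addn0; last first.
  apply/negbTE/existsP => -[j /andP[/eqP jn _]].
  by have := ltn_ord j; rewrite jn ltnn.
apply: eq_bigr => i _; rewrite unfold_in.
case: ifP => [/existsP[j /andP[/eqP ji]]|/existsP H].
  by have -> : j = lift ord0 i by [apply: val_inj; rewrite /= ji]; move->.
case: ltnP => // lt; case: H; exists (lift ord0 i).
by rewrite lt eqxx.
Qed.

(** Letters of [s] that are at least [j] are raised by one, which preserves their relative order,
    and the raised [s ord0] lies below [j] exactly when [s ord0] does. *)
Lemma des_lift_perm n (j : 'I_n.+2) (s : 'S_n.+1) :
  des (lift_perm ord0 j s) = ((s ord0 < j) + des s)%N.
Proof.
rewrite !des_sum big_ord_recl; congr (_ + _)%N.
  have -> : widen_ord (leqnSn n.+1) ord0 = ord0 by apply: val_inj.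
  rewrite lift_perm_lift lift_perm_id /= /bump.
  by congr (nat_of_bool _); case: leqP; lia.
apply: eq_bigr => i _; congr (nat_of_bool _).
have -> : widen_ord (leqnSn n.+1) (lift ord0 i)
  = lift ord0 (widen_ord (leqnSn n) i) by apply: val_inj.
rewrite !lift_perm_lift /= /bump.
by do 2!case: leqP; lia.
Qed.

Lemma lift_perm_bij n :
  bijective (fun p : 'I_n.+1 * 'S_n => lift_perm ord0 p.1 p.2).
Proof.
apply: inj_card_bij => [[i s] [j u] /= /permP e|].
  have ij : i = j by have := e ord0; rewrite !lift_perm_id.
  subst j; congr pair; apply/permP => k.
  by have := e (lift ord0 k); rewrite !lift_perm_lift => /lift_inj.
by rewrite card_prod !card_Sn card_ord.
Qed.

(** * Eulerian polynomials refined by the first letter *)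

Section Refined.
Variable R : comNzRingType.
Implicit Types (w : {poly R}) (n : nat).

(* [first_eulerian w n j] enumerates the permutations of n + 1 letters with
   first letter j by descents, odd permutations being weighted by w; removing
   the first letter gives the recursion. *)
Fixpoint first_eulerian w n (j : nat) : {poly R} :=
  if n is n'.+1 then
    w ^+ j * ('X * \sum_(0 <= i < j) first_eulerian w n' i +
              \sum_(j <= i < n) first_eulerian w n' i)
  else 1.

Lemma first_eulerianE w n (j : 'I_n.+1) : w ^+ 2 = 1 ->
  \sum_(s : 'S_n.+1 | s ord0 == j) w ^+ (odd_perm s) * 'X^(des s) =
  first_eulerian w n j.
Proof.
move=> w2; elim: n j => [|n IH] j.
  rewrite (big_pred1 1%g) => [|s].
    by rewrite odd_perm1 des_sum big_ord0 mulr1.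
  rewrite /= (ord1 j) (ord1 (s ord0)); apply/esym/eqP.
  by apply/permP => i; rewrite perm1 (ord1 i) (ord1 (s _)).
rewrite (reindex _ (onW_bij _ (lift_perm_bij n.+1))) /=.
under eq_bigl => p do rewrite lift_perm_id -[_ == _]andbT.
rewrite -(pair_big_dep (fun i => i == j) (fun _ _ => true)
  (fun i s => w ^+ odd_perm (lift_perm ord0 i s) * 'X^(des (lift_perm ord0 i s)))) /=.
rewrite big_pred1_eq.
rewrite (eq_bigr (fun s : 'S_n.+1 => w ^+ j *
    ('X^(s ord0 < j)%N * (w ^+ odd_perm s * 'X^(des s))))); last first.
  move=> s _; rewrite odd_lift_perm des_lift_perm exprD /=.
  (* A first letter [j] creates [j] inversions; as [w ^+ 2 = 1], only their parity matters. *)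
  have -> : w ^+ (odd j (+) s) = w ^+ j * w ^+ s.
    rewrite -[in RHS](odd_double_half j) -mul2n exprD exprM w2 expr1n mulr1.
    by case: (odd j) (odd_perm s) => -[]; rewrite ?mulr1 ?mul1r // -expr2 w2.
  by rewrite -!mulrA [w ^+ s * _]mulrCA.
rewrite -big_distrr; congr (_ * _).
rewrite (partition_big (fun s : 'S_n.+1 => s ord0) xpredT) //=.
rewrite (eq_bigr (fun i : 'I_n.+1 => 'X^(i < j)%N * first_eulerian w n i)).
  rewrite -(big_mkord xpredT (fun i => 'X^(i < j)%N * first_eulerian w n i)).
  rewrite (big_cat_nat (n := j)) //=; last by rewrite -ltnS.
  rewrite big_distrr; congr (_ + _); apply: eq_big_nat => i /andP[ij ji].
    by rewrite ji expr1.
  by rewrite ltnNge ij mul1r.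
move=> i _; rewrite -IH // big_distrr.
by apply: eq_bigr => s /eqP ->.
Qed.

(** For positive [n], this is A_n at [w = 1] and D_n at [w = -1]; [n] counts letters, hence the
    [n.-1]. *)
Definition weighted_eulerian w n := \sum_(0 <= i < n) first_eulerian w n.-1 i.

Lemma weighted_eulerianE w n : w ^+ 2 = 1 ->
  \sum_(s : 'S_n.+1) w ^+ (odd_perm s) * 'X^(des s) = weighted_eulerian w n.+1.
Proof.
move=> w2; rewrite (partition_big (fun s : 'S_n.+1 => s ord0) xpredT) //=.
rewrite /weighted_eulerian big_mkord; apply: eq_bigr => i _.
exact: first_eulerianE.
Qed.

End Refined.

(** * Factorization of the signed polynomials and the derivative recursion *)

Section Identities.
Variable R : comNzRingType.
Local Notation f := (@first_eulerian R 1).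
Local Notation g := (@first_eulerian R (-1)).

Lemma first_eulerianS w n j : (j <= n.+1)%N ->
  @first_eulerian R w n.+1 j = w ^+ j *
    (weighted_eulerian w n.+1 - (1 - 'X) * \sum_(0 <= i < j) first_eulerian w n i).
Proof.
move=> jn; rewrite /weighted_eulerian /= (big_cat_nat (leq0n j) jn) /=.
by congr (_ * _); ring.
Qed.

Arguments first_eulerian {R} w n j : simpl never.

Lemma first_eulerian0 w n :
  @first_eulerian R w n.+1 0 = weighted_eulerian w n.+1.
Proof. by rewrite first_eulerianS // big_geq // mulr0 subr0 mul1r. Qed.

Lemma first_eulerian1S n j : (j <= n)%N ->
  f n.+1 j.+1 = f n.+1 j - (1 - 'X) * f n j.
Proof.
move=> jn; rewrite !first_eulerianS ?(leqW jn) // !expr1n big_nat_recr //=.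
by ring.
Qed.

(** Consecutive first letters carry opposite signs, so the totals cancel and of the two partial sums
    only the term [j] survives. *)
Lemma first_eulerianN1_pair n j : (j <= n)%N ->
  g n.+1 j + g n.+1 j.+1 = (-1) ^+ j * (1 - 'X) * g n j.
Proof.
move=> jn; rewrite !first_eulerianS ?(leqW jn) // big_nat_recr //= exprS.
by ring.
Qed.

(** The letters 2i and 2i+1 are paired, giving [1 - 'X] times a term one level down;
    [first_eulerianS] expresses that term by even partial sums one level further down, where the
    induction on [k] applies. *)
Lemma sum_first_eulerianN1_even k j : (j <= k.+1)%N ->
  \sum_(0 <= i < j.*2) g k.*2.+1 i =
  (1 - 'X) ^+ k.+1 * \sum_(0 <= i < j) f k i.
Proof.
elim: k j => [|k IHk]; elim=> [|j IHj] jk.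
- by rewrite !big_geq // mulr0.
- move: jk; rewrite ltnS leqn0 => /eqP ->.
  rewrite (big_nat_recr 1) // !big_nat1 /= first_eulerianN1_pair //.
  by rewrite mul1r.
- by rewrite !big_geq // mulr0.
rewrite doubleS !big_nat_recr //= IHj 1?ltnW // -addrA.
rewrite first_eulerianN1_pair; last by rewrite doubleS; lia.
rewrite -signr_odd odd_double mul1r mulrDr; congr (_ + _).
rewrite doubleS !first_eulerianS; try lia.
rewrite -signr_odd odd_double mul1r expr1n mul1r.
rewrite /weighted_eulerian -doubleS !IHk; try lia.
by rewrite [in RHS]exprS; ring.
Qed.

Lemma weighted_eulerianN1_even k :
  weighted_eulerian (-1) k.+1.*2 =
  (1 - 'X) ^+ k.+1 * weighted_eulerian 1 k.+1 :> {poly R}.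
Proof. by rewrite /weighted_eulerian sum_first_eulerianN1_even. Qed.

(** Here letter 0 stands alone and is given by the even case; the pairs are 2i+1 and 2i+2. *)
Lemma sum_first_eulerianN1_odd k j : (j <= k)%N ->
  \sum_(0 <= i < j.*2.+1) g k.*2 i =
  (1 - 'X) ^+ k * \sum_(0 <= i < j.+1) f k i.
Proof.
elim: k j => [|k IHk]; elim=> [|j IHj] jk //.
- by rewrite !big_nat1 mul1r.
- rewrite !big_nat1 doubleS !first_eulerian0 -doubleS.
  exact: weighted_eulerianN1_even.
rewrite doubleS big_nat_recr // big_nat_recr //= IHj 1?ltnW // -addrA [k.+1.*2]doubleS.
rewrite first_eulerianN1_pair; last by lia.
rewrite [in RHS]big_nat_recr //= [RHS]mulrDr; congr (_ + _).
rewrite !first_eulerianS; try lia.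
rewrite /weighted_eulerian /= !IHk; try lia.
rewrite expr1n mul1r -signr_odd /= odd_double expr1 [in RHS]exprS.
by ring.
Qed.

Lemma weighted_eulerianN1_odd k :
  weighted_eulerian (-1) k.*2.+1 =
  (1 - 'X) ^+ k * weighted_eulerian 1 k.+1 :> {poly R}.
Proof. by rewrite /weighted_eulerian sum_first_eulerianN1_odd. Qed.

Definition eulerian_op n (u : {poly R}) :=
  (1 + n%:R * 'X) * u + 'X * (1 - 'X) * u^`().

Lemma eulerian_op_sum n (I : Type) (r : seq I) (u : I -> {poly R}) :
  eulerian_op n (\sum_(i <- r) u i) = \sum_(i <- r) eulerian_op n (u i).
Proof.
by rewrite /eulerian_op raddf_sum !big_distrr -big_split.
Qed.

(** The derivative recursion holds for each first letter separately. Letter 0 follows by summing the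
    previous level, since raising [n] by one in [eulerian_op n u] adds ['X * u]. The passage from
    [j] to [j.+1] uses [eulerian_op n.+1 ((1 - 'X) * u) = (1 - 'X) * eulerian_op n u]. *)
Lemma first_eulerian_op n j : (j <= n)%N ->
  f n.+1 j = eulerian_op n (f n j).
Proof.
elim: n j => [|n IHn].
  move=> j; rewrite leqn0 => /eqP ->; rewrite first_eulerian0.
  by rewrite /weighted_eulerian big_nat1 /eulerian_op derivC; ring.
elim=> [|j IHj] jn.
  rewrite first_eulerian0 /weighted_eulerian big_nat_recr //=.
  rewrite (first_eulerianS _ (leqnn n.+1)).
  rewrite first_eulerian0 /weighted_eulerian /= expr1n.
  rewrite (eq_big_nat _ _ (F2 := fun i => eulerian_op n (f n i))) => [|i /andP[_ ?]].
    rewrite -eulerian_op_sum /eulerian_op; set S := \sum_(0 <= i < n.+1) _.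
    by rewrite -natr1; ring.
  exact: IHn.
rewrite (first_eulerian1S (n := n.+1)) ?(ltnW jn) // IHj 1?ltnW // (first_eulerian1S (n := n)) // (IHn j) //.
rewrite /eulerian_op derivB derivM derivB derivC derivX -natr1.
by ring.
Qed.

Lemma weighted_eulerian1S n :
  weighted_eulerian 1 n.+2 = eulerian_op n.+1 (weighted_eulerian 1 n.+1).
Proof. by rewrite -!first_eulerian0 -first_eulerian_op. Qed.

End Identities.

(** * Gamma coefficients of the Eulerian polynomials *)

(* The subtraction d' - 2 * i' is truncated, which makes the coefficients vanish
   beyond d / 2. *)
Fixpoint gamma_coef (d i : nat) : nat :=
  match d, i with
  | 0, i => (i == 0)%N
  | d'.+1, 0 => gamma_coef d' 0
  | d'.+1, i'.+1 =>
      i.+1 * gamma_coef d' i + 2 * (d' - 2 * i') * gamma_coef d' i'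
  end%N.

Lemma gamma_coefSS d i : gamma_coef d.+1 i.+1 =
  (i.+2 * gamma_coef d i.+1 + 2 * (d - 2 * i) * gamma_coef d i)%N.
Proof. by []. Qed.

Lemma gamma_coef_eq0 d i : (d < 2 * i)%N -> gamma_coef d i = 0%N.
Proof.
elim: d i => [|d IH] [|i] di //.
rewrite gamma_coefSS IH ?muln0; last by lia.
by have -> : (d - 2 * i)%N = 0%N by lia.
Qed.

Lemma leq_gamma_coef d i : (gamma_coef d i <= gamma_coef d.+1 i)%N.
Proof. by case: i => [//|i]; rewrite gamma_coefSS mulSn -addnA leq_addr. Qed.

(** For odd [d], 2i <= d forces 2i < d, so the factor 2(d + 1 - 2i) in the recursion is at least
    4. *)
Lemma gamma_coef_add2 d i : odd d ->
  (gamma_coef d i.+1 + 4 * gamma_coef d i <= gamma_coef d.+2 i.+1)%N.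
Proof.
move=> dodd; rewrite gamma_coefSS; apply: leq_add.
  exact: leq_trans (leq_gamma_coef _ _) (leq_pmull _ _).
have [/gamma_coef_eq0 -> //|di] := ltnP d (2 * i).
by apply: leq_mul (leq_gamma_coef _ _); lia.
Qed.

(** * Gamma expansions and the operators acting on them *)

Section GammaSum.
Variable R : realFieldType.
Implicit Types (c : nat -> R) (d : nat).

Definition gamma_basis d i : {poly R} := 'X^i * (1 + 'X) ^+ (d - 2 * i).

Definition gamma_sum d c := \sum_(0 <= i < (d./2).+1) c i *: gamma_basis d i.

(** Vanishing beyond d/2 lets the summation range be extended freely, so that index shifts need not
    follow the floor of d/2. *)
Definition gamma_supported d c := forall i, (d < 2 * i)%N -> c i = 0.

Lemma gamma_sum_widen d e c : gamma_supported d c -> (d./2 <= e)%N ->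
  gamma_sum d c = \sum_(0 <= i < e.+1) c i *: gamma_basis d i.
Proof.
move=> sc de; rewrite [RHS](big_cat_nat (n := (d./2).+1)) //=.
rewrite [X in _ + X]big_nat_cond [X in _ + X]big1 ?addr0 // => i.
by rewrite andbT => /andP[di _]; rewrite sc ?scale0r //; lia.
Qed.

Lemma gamma_basisS d i : (2 * i <= d)%N ->
  gamma_basis d.+1 i = (1 + 'X) * gamma_basis d i.
Proof. by move=> di; rewrite /gamma_basis subSn // exprS mulrCA. Qed.

Lemma gamma_sumS d c : gamma_supported d c ->
  (1 + 'X) * gamma_sum d c = gamma_sum d.+1 c.
Proof.
move=> sc; rewrite (@gamma_sum_widen d.+1 d) //; last first.
- by rewrite leq_half_double; lia.
- by move=> i di; apply: sc; lia.
rewrite (gamma_sum_widen sc (e := d)); last by lia.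
rewrite big_distrr; apply: eq_bigr => i _ /=.
case: (leqP (2 * i) d) => [di|/sc ->]; last by rewrite !scale0r mulr0.
by rewrite gamma_basisS // -scalerAr.
Qed.

Lemma sub1X_sqr_gamma_basis d i : (2 * i <= d)%N ->
  (1 - 'X) ^+ 2 * gamma_basis d i =
  gamma_basis d.+2 i - 4%:R *: gamma_basis d.+2 i.+1.
Proof.
move=> di; rewrite /gamma_basis.
have -> : (d.+2 - 2 * i = (d - 2 * i).+2)%N by lia.
have -> : (d.+2 - 2 * i.+1 = d - 2 * i)%N by lia.
rewrite !exprS scaler_nat; move: ((1 + 'X) ^+ _) 'X^i => y x.
by ring.
Qed.

Lemma eulerian_op_gamma_basis d i : (2 * i <= d)%N ->
  eulerian_op d.+1 (gamma_basis d i) =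
  (i.+1)%:R *: gamma_basis d.+1 i +
  (2 * (d - 2 * i))%:R *: gamma_basis d.+1 i.+1.
Proof.
move=> di; have [e de] : exists e, d = (2 * i + e)%N by exists (d - 2 * i)%N; lia.
rewrite /gamma_basis /eulerian_op !scaler_nat de.
have -> : (2 * i + e - 2 * i = e)%N by lia.
have -> : ((2 * i + e).+1 - 2 * i = e.+1)%N by lia.
have -> : ((2 * i + e).+1 - 2 * i.+1 = e.-1)%N by lia.
rewrite derivM derivXn deriv_exp derivD derivC derivX add0r mul1r.
rewrite mulrnA -(mulr_natr (_ *+ 2) e) -(mulr_natr _ i.+1).
rewrite -(mulr_natr ((1 + 'X) ^+ _) e) -(mulr_natr 'X^_ i) !exprS.
(* Differentiation produces truncated predecessors; the factors [i] and [e] keep these identities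
   true at 0. *)
have Xi : 'X * ('X^(i.-1) * i%:R) - i%:R * 'X^i = 0 :> {poly R}.
  by case: (i) => [|k]; rewrite ?mulr0 ?mul0r ?subrr // mulrA -exprS mulrC subrr.
have Ye : (1 + 'X) * ((1 + 'X) ^+ e.-1 * e%:R) - e%:R * (1 + 'X) ^+ e = 0 :> {poly R}.
  by case: (e) => [|k]; rewrite ?mulr0 ?mul0r ?subrr // mulrA -exprS mulrC subrr.
have -> : (2 * i + e).+1%:R = 2 * i%:R + e%:R + 1 :> {poly R}.
  by rewrite -natr1 natrD natrM.
rewrite -(natr1 i); apply/eqP; rewrite -subr_eq0; apply/eqP.
move: Xi Ye; move: 'X^(i.-1) 'X^i ((1 + 'X) ^+ e.-1) ((1 + 'X) ^+ e).
move: (i%:R : {poly R}) (e%:R : {poly R}) => a b x' x y' y Xi Ye.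
(* The difference of the two sides is a combination of the vanishing expressions in [Xi] and
   [Ye]. *)
transitivity ((1 - 'X) * y * ('X * (x' * a) - a * x)
  - 'X * x * ((1 + 'X) * (y' * b) - b * y)); first by ring.
by rewrite Xi Ye !mulr0 subrr.
Qed.

Lemma eulerian_op_gamma_sum d c : gamma_supported d c ->
  eulerian_op d.+1 (gamma_sum d c) =
  gamma_sum d.+1 (fun i => if i is i'.+1 then
      (i.+1)%:R * c i + (2 * (d - 2 * i'))%:R * c i' else c 0%N).
Proof.
move=> sc; rewrite (gamma_sum_widen sc (e := d)); last by lia.
rewrite (@gamma_sum_widen _ d.+1); first 1 last.
- case=> [|i] di /=; first by lia.
  rewrite (sc i.+1) ?mulr0 ?add0r; last by lia.
  by rewrite (_ : (d - 2 * i = 0)%N) ?mul0r //; lia.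
- by lia.
rewrite eulerian_op_sum (eq_bigr (fun i =>
   (i.+1%:R * c i) *: gamma_basis d.+1 i +
   ((2 * (d - 2 * i))%:R * c i) *: gamma_basis d.+1 i.+1)); last first.
  move=> i _; have lin a u : eulerian_op d.+1 (a *: u) = a *: eulerian_op d.+1 u.
    by rewrite /eulerian_op derivZ -!scalerAr -scalerDr.
  rewrite lin; case: (leqP (2 * i) d) => [di|/sc ->]; last first.
    by rewrite !mulr0 !scale0r addr0.
  rewrite eulerian_op_gamma_basis // scalerDr !scalerA.
  by rewrite ![c i * _]mulrC.
rewrite big_split /= [in RHS]big_nat_recl //=.
under [in RHS]eq_bigr do rewrite scalerDl.
rewrite big_split /= addrA; congr (_ + _).
transitivity (\sum_(0 <= i < d.+2) (i.+1%:R * c i) *: gamma_basis d.+1 i).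
  by rewrite [RHS]big_nat_recr //= (sc d.+1) ?mulr0 ?scale0r ?addr0 //; lia.
by rewrite [LHS]big_nat_recl //= mul1r.
Qed.

Lemma gamma_coef_supported d : gamma_supported d (fun i => (gamma_coef d i)%:R).
Proof. by move=> i /gamma_coef_eq0 ->. Qed.

Lemma eq_gamma_sum d c c' : c =1 c' -> gamma_sum d c = gamma_sum d c'.
Proof. by move=> cc; apply: eq_bigr => i _; rewrite cc. Qed.

Lemma weighted_eulerian1E d :
  weighted_eulerian 1 d.+1 = gamma_sum d (fun i => (gamma_coef d i)%:R).
Proof.
elim: d => [|d IH].
  by rewrite /weighted_eulerian /gamma_sum !big_nat1 /gamma_basis scale1r mulr1.
rewrite weighted_eulerian1S IH.
rewrite (eulerian_op_gamma_sum (@gamma_coef_supported d)).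
by apply: eq_gamma_sum => -[|i] //; rewrite gamma_coefSS natrD !natrM.
Qed.

Lemma sub1X_sqr_gamma_sum d c : gamma_supported d c ->
  (1 - 'X) ^+ 2 * gamma_sum d c =
  gamma_sum d.+2 (fun i => c i - if i is i'.+1 then 4 * c i' else 0).
Proof.
move=> sc; rewrite (gamma_sum_widen sc (e := d)); last by lia.
rewrite (@gamma_sum_widen _ d.+1); first 1 last.
- case=> [|i] di /=; first by lia.
  by rewrite !sc ?mulr0 ?subrr //; lia.
- by lia.
rewrite big_distrr (eq_bigr (fun i =>
   c i *: gamma_basis d.+2 i - (4 * c i) *: gamma_basis d.+2 i.+1)); last first.
  move=> i _ /=; case: (leqP (2 * i) d) => [di|/sc ->]; last first.
    by rewrite mulr0 !scale0r mulr0 subrr.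
  by rewrite -scalerAr sub1X_sqr_gamma_basis // scalerBr scalerA mulrC.
under [in RHS]eq_bigr do rewrite scalerBl.
rewrite !sumrB; congr (_ - _).
  by rewrite [RHS]big_nat_recr //= (sc d.+1) ?scale0r ?addr0 //; lia.
by rewrite [RHS]big_nat_recl //= scale0r add0r.
Qed.

(* Each factor (1 - t)^2 = (1 + t)^2 - 4t changes the gamma coefficients by
   c_i - 4 c_(i-1), while two Eulerian steps add at least 4 c_(i-1). *)
Lemma signed_gamma_sum_bound k s : exists c : nat -> R,
  [/\ gamma_supported (2 * (k + s)).+1 c,
      forall i, `|c i| <= (gamma_coef (2 * (k + s)).+1 i)%:R &
      (1 - 'X) ^+ (2 * s) * weighted_eulerian 1 (2 * k).+2 =
      gamma_sum (2 * (k + s)).+1 c].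
Proof.
elim: s => [|s [c [sc bc ec]]].
  rewrite addn0; exists (fun i => (gamma_coef (2 * k).+1 i)%:R); split.
  - exact: gamma_coef_supported.
  - by move=> i; rewrite ger0_norm.
  - by rewrite mul1r weighted_eulerian1E.
exists (fun i => c i - if i is i'.+1 then 4 * c i' else 0).
have -> : ((2 * (k + s.+1)).+1 = (2 * (k + s)).+3)%N by lia.
split.
- move=> [|i] di /=; first by lia.
  by rewrite !sc ?mulr0 ?subrr //; lia.
- move=> [|i]; first by rewrite subr0.
  apply: (le_trans (ler_normB _ _)); rewrite normrM normr_nat.
  apply: (@le_trans _ _ (gamma_coef (2 * (k + s)).+1 i.+1
                          + 4 * gamma_coef (2 * (k + s)).+1 i)%:R).
    by rewrite natrD natrM lerD // ler_wpM2l.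
  by rewrite ler_nat gamma_coef_add2 //= mul2n odd_double.
- by rewrite -sub1X_sqr_gamma_sum // -ec mulrA -exprD; congr (_ ^+ _ * _); lia.
Qed.

End GammaSum.

(** * Gamma positivity and sums of three summands *)

Section GammaPositive.
Variable R : realFieldType.
Implicit Types (f : {poly R}) (c : nat -> R) (r d : nat).

Lemma low_degE f r : f`_r != 0 -> (forall i, (i < r)%N -> f`_i = 0) ->
  low_deg f = r.
Proof.
move=> fr f0; have rf : (r < size f)%N.
  by rewrite ltnNge; apply: contra fr => /(nth_default 0) ->.
have hf : has (fun a => a != 0) f by apply/(has_nthP 0); exists r.
apply/eqP; rewrite eqn_leq /low_deg; apply/andP; split.
  by rewrite leqNgt; apply/negP => /(before_find 0); rewrite fr.
by rewrite leqNgt; apply/negP => /f0 E; have := nth_find 0 hf; rewrite E eqxx.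
Qed.

Lemma high_degE f N : f`_N != 0 -> (forall i, (N < i)%N -> f`_i = 0) ->
  high_deg f = N.
Proof.
move=> fN f0; rewrite /high_deg; suff -> : size f = N.+1 by [].
apply/eqP; rewrite eqn_leq; apply/andP; split; first exact/leq_sizeP.
by rewrite ltnNge; apply: contra fN => /(nth_default 0) ->.
Qed.

Lemma coef_1DX_exp n j : ((1 + 'X) ^+ n : {poly R})`_j = 'C(n, j)%:R.
Proof.
elim: n j => [|n IH] j; first by rewrite coef1 bin0n.
rewrite exprS mulrDl mul1r coefD coefXM; case: j => [|j] /=.
  by rewrite IH !bin0 addr0.
by rewrite !IH binS natrD.
Qed.

Lemma coef_gamma_basis d i j :
  (gamma_basis R d i)`_j = if (j < i)%N then 0 else 'C(d - 2 * i, j - i)%:R.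
Proof. by rewrite /gamma_basis coefXnM coef_1DX_exp. Qed.

Lemma coef_gamma_sum_gt d c j : (d < j)%N -> (gamma_sum d c)`_j = 0.
Proof.
move=> dj; rewrite coef_sum big_nat_cond big1 // => i.
rewrite andbT => /andP[_ id]; rewrite coefZ coef_gamma_basis.
by case: ltnP => ij; rewrite ?bin_small ?mulr0 //; lia.
Qed.

Lemma coef_gamma_sum_sym d c j : (j <= d)%N ->
  (gamma_sum d c)`_j = (gamma_sum d c)`_(d - j).
Proof.
move=> jd; rewrite !coef_sum; apply: eq_big_nat => i /andP[_ id].
rewrite !coefZ !coef_gamma_basis; congr (_ * _).
(* If j < i, then d - j - i exceeds d - 2i and the binomial on the other side vanishes. *)
case: ltnP => ij; case: ltnP => dij //.
- by rewrite bin_small //; lia.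
- by rewrite bin_small //; lia.
- by rewrite -bin_sub; [congr ('C(_, _)%:R); lia | lia].
Qed.

Lemma coef0_gamma_sum d c : (gamma_sum d c)`_0 = c 0%N.
Proof.
rewrite coef_sum big_nat_recl //= big1 => [|i _].
  by rewrite coefZ coef_gamma_basis /= bin0 mulr1 addr0.
by rewrite coefZ coef_gamma_basis /= mulr0.
Qed.

(** The nonzero [c 0] is the coefficient at degree [r] and, by symmetry, at degree [r + d]; this
    fixes both extreme degrees, so the given sum is already the required expansion. *)
Lemma gamma_positive_XnM_gamma_sum r d c : c 0%N != 0 ->
  (forall i, (i <= d./2)%N -> 0 <= c i) ->
  gamma_positive ('X^r * gamma_sum d c).
Proof.
move=> c0 cp; set f := 'X^r * _.
have fr i : f`_(r + i) = (gamma_sum d c)`_i.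
  by rewrite coefXnM ltnNge leq_addr /= addKn.
have fl : low_deg f = r.
  apply: low_degE => [|i ir]; last by rewrite coefXnM ir.
  by rewrite -[r]addn0 fr coef0_gamma_sum.
have fh : high_deg f = (r + d)%N.
  apply: high_degE => [|i].
    by rewrite fr coef_gamma_sum_sym // subnn coef0_gamma_sum.
  move=> ri; have -> : (i = r + (i - r))%N by lia.
  by rewrite fr coef_gamma_sum_gt //; lia.
rewrite /gamma_positive /palindromic fl fh addKn; split; [split|].
- by apply: contraNneq c0 => f0; rewrite -(coef0_gamma_sum d) -fr f0 coef0.
- move=> i id; have -> : (r + d - i = r + (d - i))%N by lia.
  by rewrite !fr coef_gamma_sum_sym //; lia.
- exists c; split=> //.
  rewrite /f big_distrr; apply: eq_bigr => i _ /=.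
  by rewrite -scalerAr /gamma_basis mulrA -exprD.
Qed.

Lemma gamma_sum_shift d c k : (2 * k <= d)%N -> (forall i, (i < k)%N -> c i = 0) ->
  gamma_sum d c = 'X^k * gamma_sum (d - 2 * k) (fun i => c (k + i)%N).
Proof.
move=> kd ck; rewrite /gamma_sum (big_cat_nat (n := k)) //=; last by lia.
rewrite big_nat_cond big1 ?add0r => [|i /andP[/andP[_ ik] _]]; last first.
  by rewrite ck // scale0r.
rewrite -{1}[k]addn0 addnC big_addn big_distrr /=.
have -> : (d./2.+1 - k = (d - 2 * k)./2.+1)%N by lia.
apply: eq_bigr => i _; rewrite -scalerAr /gamma_basis mulrA -exprD addnC.
by congr (_ *: (_ * _ ^+ _)); lia.
Qed.

(** A relaxation of gamma positivity that admits 0 and vanishing leading coefficients, so that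
    summands can be formed before it is known whether they vanish. *)
Definition in_gamma_cone f := exists r d c,
  (forall i, 0 <= c i) /\ f = 'X^r * gamma_sum d c.

Lemma gamma_sumZ d c a : gamma_sum d (fun i => a * c i) = a *: gamma_sum d c.
Proof. by rewrite scaler_sumr; apply: eq_bigr => i _; rewrite scalerA. Qed.

Lemma gamma_sumD d c c' :
  gamma_sum d (fun i => c i + c' i) = gamma_sum d c + gamma_sum d c'.
Proof. by rewrite -big_split; apply: eq_bigr => i _; rewrite scalerDl. Qed.

Lemma in_gamma_coneZ a f : 0 <= a -> in_gamma_cone f -> in_gamma_cone (a *: f).
Proof.
move=> a0 [r [d [c [cp ->]]]]; exists r, d, (fun i => a * c i); split.
  by move=> i; rewrite mulr_ge0.
by rewrite gamma_sumZ scalerAr.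
Qed.

Lemma in_gamma_cone_positive f : in_gamma_cone f -> f != 0 -> gamma_positive f.
Proof.
move=> [r [d [c [cp ->]]]] f0.
have ex : exists k, (k <= d./2)%N && (c k != 0).
  have [/hasP[k]|/hasPn c0] := boolP (has (fun k => c k != 0) (iota 0 d./2.+1)).
    by rewrite mem_iota add0n => /andP[_ kd] ck; exists k; rewrite -ltnS kd.
  case/eqP: f0; rewrite /gamma_sum big_seq big1 ?mulr0 // => k.
  by rewrite mem_index_iota => kd; rewrite (eqP (negPn (c0 k _))) ?scale0r ?mem_iota.
(* Factoring out ['X^k] for the least index [k] with [c k != 0] makes the first coefficient
   nonzero. *)
case: (ex_minnP ex) => k /andP[kd ck] kmin.
rewrite (gamma_sum_shift (k := k)) ?mulrA -?exprD; first 1 last.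
- by lia.
- move=> i ik; apply/eqP; apply: contraLR (ik) => ci.
  by rewrite -leqNgt kmin // ci andbT; lia.
by apply: gamma_positive_XnM_gamma_sum; rewrite ?addn0.
Qed.

Lemma in_gamma_cone_split f g : in_gamma_cone f -> in_gamma_cone g -> g != 0 ->
  exists f' g', [/\ in_gamma_cone f', in_gamma_cone g', f' != 0, g' != 0
                  & f + g = f' + g'].
Proof.
move=> cf cg g0; have [->|f0] := eqVneq f 0; last by exists f, g.
have cg2 : in_gamma_cone (2^-1 *: g) by apply: in_gamma_coneZ => //; lra.
have g2 : 2^-1 *: g != 0 by rewrite scaler_eq0 invr_eq0 pnatr_eq0.
exists (2^-1 *: g), (2^-1 *: g); split=> //.
by rewrite add0r -scalerDl (_ : _ + _ = 1) ?scale1r //; field.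
Qed.

Lemma in_gamma_cone_sum3 f1 f2 f3 :
  in_gamma_cone f1 -> in_gamma_cone f2 -> in_gamma_cone f3 ->
  f1 + f2 + f3 != 0 -> sum_of_three_gamma_positive (f1 + f2 + f3).
Proof.
(* Up to reordering the third summand is nonzero; two splittings then make the other two nonzero as
   well. *)
suff H g1 g2 g3 : in_gamma_cone g1 -> in_gamma_cone g2 -> in_gamma_cone g3 ->
    g3 != 0 -> sum_of_three_gamma_positive (g1 + g2 + g3).
  move=> c1 c2 c3 f0.
  have [f30|?] := eqVneq f3 0; last exact: H.
  have [f20|?] := eqVneq f2 0; last by rewrite addrAC; apply: H.
  rewrite -addrA addrC; apply: H => //.
  by apply: contraNneq f0 => ->; rewrite f20 f30 !addr0.
move=> c1 c2 c3 g30.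
have [h2 [h3 [ch2 ch3 h20 h30 e23]]] := in_gamma_cone_split c2 c3 g30.
have [h1 [k3 [ch1 ck3 h10 k30 e13]]] := in_gamma_cone_split c1 ch3 h30.
exists h1, h2, k3; split; try exact: in_gamma_cone_positive.
by rewrite -addrA e23 addrCA e13 addrA [RHS]addrAC [RHS]addrC addrA.
Qed.

Lemma horner1_gamma_sum_gt0 d c : (forall i, 0 <= c i) -> 0 < c 0%N ->
  0 < (gamma_sum d c).[1].
Proof.
move=> cp c0; rewrite horner_sum.
have E i : (c i *: gamma_basis R d i).[1] = c i * 2 ^+ (d - 2 * i).
  by rewrite hornerZ hornerM hornerXn expr1n mul1r horner_exp !hornerE.
rewrite big_nat_recl // ltr_pwDl ?sumr_ge0 // => [|i _]; rewrite E.
  by rewrite mulr_gt0 ?exprn_gt0.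
by rewrite mulr_ge0 ?exprn_ge0.
Qed.

Lemma sum_of_three_gamma_positive_half d (a c : nat -> R) :
  gamma_supported d c -> (forall i, `|c i| <= a i) -> 0 < a 0%N ->
  sum_of_three_gamma_positive
    (2^-1 *: (gamma_sum d.+1 a + (1 - 'X) * gamma_sum d c)).
Proof.
move=> sc ca a0; have ap i : 0 <= a i by exact: le_trans (ca i).
pose n i := `|c i|.
have sn : gamma_supported d n by move=> i /sc ci; rewrite /n ci normr0.
(* Multiplication by [1 + 'X] keeps the gamma coefficients, so those of |u| can be subtracted from
   [a] at degree [d.+1]. *)
have E : gamma_sum d.+1 a + (1 - 'X) * gamma_sum d c =
    gamma_sum d.+1 (fun i => a i + -1 * n i) + gamma_sum d (fun i => n i + c i)
    + 'X * gamma_sum d (fun i => n i + -1 * c i).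
  rewrite !gamma_sumD !gamma_sumZ -(gamma_sumS sn) !scaleN1r.
  by ring.
(* At 1 the term with the factor [1 - 'X] vanishes while the other one is positive. *)
have F0 : 2^-1 *: (gamma_sum d.+1 a + (1 - 'X) * gamma_sum d c) != 0.
  rewrite scaler_eq0 invr_eq0 pnatr_eq0 /=; apply/eqP => /(congr1 (horner^~ 1)).
  rewrite !hornerE subrr mul0r addr0 => a1.
  by have := horner1_gamma_sum_gt0 d.+1 ap a0; rewrite a1 ltxx.
move: F0; rewrite E !scalerDr => F0; apply: in_gamma_cone_sum3 F0.
all: apply: in_gamma_coneZ; first by lra.
- exists 0%N, d.+1, (fun i => a i + -1 * n i); rewrite mul1r; split=> // i.
  by rewrite mulN1r subr_ge0 ca.
- exists 0%N, d, (fun i => n i + c i); rewrite mul1r; split=> // i.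
  by rewrite /n -lerBlDr sub0r -normrN ler_norm.
- exists 1%N, d, (fun i => n i + -1 * c i); split=> // i.
  by rewrite /n mulN1r subr_ge0 ler_norm.
Qed.

End GammaPositive.

(** * Even and odd permutations, and the conclusion *)

Lemma eulerian_plusE n : eulerian_plus n.+1 =
  2^-1 *: (weighted_eulerian 1 n.+1 + weighted_eulerian (-1) n.+1).
Proof.
rewrite -!weighted_eulerianE ?expr1n ?sqrrN ?expr1n //.
rewrite -big_split /= scaler_sumr /eulerian_plus big_mkcond /=.
apply: eq_bigr => s _; rewrite Alt_even expr1n mul1r.
case: (odd_perm s); rewrite /= ?expr1 ?mulN1r ?subrr ?scaler0 // mul1r.
by rewrite -mulr2n -scaler_nat scalerA mulVf ?scale1r.
Qed.

Lemma eulerian_minusE n : eulerian_minus n.+1 =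
  2^-1 *: (weighted_eulerian 1 n.+1 - weighted_eulerian (-1) n.+1).
Proof.
rewrite -!weighted_eulerianE ?expr1n ?sqrrN ?expr1n //.
rewrite -sumrB scaler_sumr /eulerian_minus big_mkcond /=.
apply: eq_bigr => s _; rewrite Alt_even expr1n mul1r.
case: (odd_perm s); rewrite /= ?mul1r ?subrr ?scaler0 // expr1 mulN1r opprK.
by rewrite -mulr2n -scaler_nat scalerA mulVf ?scale1r.
Qed.

Theorem theorem3 (m : nat) :
  sum_of_three_gamma_positive (eulerian_plus (4 * m + 3)) /\
  sum_of_three_gamma_positive (eulerian_minus (4 * m + 3)).
Proof.
have [c [sc bc ec]] := signed_gamma_sum_bound rat m m.
set d := (2 * (m + m)).+1 in sc bc ec.
have -> : (4 * m + 3 = d.+2)%N by rewrite /d; lia.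
(* D_n carries the odd power 2m+1 of [1 - 'X]; one factor is split off and the even power left over
   is the one in [ec]. *)
have signed : weighted_eulerian (-1) d.+2 = (1 - 'X) * gamma_sum d c.
  rewrite -ec mulrA -exprS -weighted_eulerianN1_odd.
  by congr (weighted_eulerian _ _); rewrite /d; lia.
have bound i : `|c i| <= (gamma_coef d.+1 i)%:R.
  by apply: le_trans (bc i) _; rewrite ler_nat leq_gamma_coef.
have pos : 0 < (gamma_coef d.+1 0)%:R :> rat.
  by rewrite ltr0n; elim: d.+1.
rewrite eulerian_plusE eulerian_minusE signed weighted_eulerian1E; split.
  exact: sum_of_three_gamma_positive_half.
have -> : - ((1 - 'X) * gamma_sum d c) = (1 - 'X) * gamma_sum d (fun i => -1 * c i).
  by rewrite gamma_sumZ scaleN1r mulrN.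
apply: sum_of_three_gamma_positive_half => // i.
  by move/sc => ->; rewrite mulr0.
by rewrite mulN1r normrN.
Qed.
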